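(* Let $P$ be a rational polyhedron in $\mathbb{R}^d$. Let $\mathcal{L}$ be a nonempty class (set) of $d$-dimensional rational polyhedra in $\mathbb{R}^d$ such that the following conditions are fulfilled. (a) There exists $k\in\mathbb{N}$ such that $\operatorname{maxfw}(L)\le k$ for every $L\in\mathcal{L}$. (b) There exists $\ell\in\mathbb{N}$ such that for every $L\in\mathcal{L}$ and every facet $F$ of $L$ one has $\bigl(\ell\operatorname{aff}(F)\bigr)\cap\mathbb{Z}^d\neq\emptyset$. Then the following statements hold. I. There exists a finite subclass $\mathcal{L}'$ of $\mathcal{L}$ such that every $L\in\mathcal{L}$ satisfies $R_{L'}(P)\subseteq R_L(P)$ for some $L'\in\mathcal{L}'$. II. One has $R_{\mathcal{L}}(P)=R_{\mathcal{L}'}(P)$ for some finite subclass $\mathcal{L}'$ of $\mathcal{L}$. III. The set $R_{\mathcal{L}}(P)$ is a rational polyhedron.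
   Context: Here $d\in\mathbb{N}=\{1,2,\ldots\}$. A polyhedron is an intersection of finitely many closed halfspaces (the empty set and $\mathbb{R}^d$ included, not necessarily bounded); it is rational if it can be written as $\{x\in\mathbb{R}^d:\langle x,a_i\rangle\le\alpha_i,\ i=1,\ldots,n\}$ with $n\ge0$, $a_i\in\mathbb{Q}^d\setminus\{o\}$, $\alpha_i\in\mathbb{Q}$, where $o$ is the origin. For a closed convex set $K\subseteq\mathbb{R}^d$ and a $d$-dimensional closed convex set $L$, $R_L(K):=\operatorname{conv}(K\setminus\operatorname{int}(L))$; for a nonempty class $\mathcal{L}$ of such sets $L$, $R_{\mathcal{L}}(K):=\bigcap_{L\in\mathcal{L}}R_L(K)$. For a nonempty closed convex set $K$ and $u\in\mathbb{R}^d$, the width function is $w(K,u)=\sup_{x\in K}\langle u,x\rangle-\inf_{x\in K}\langle u,x\rangle\in\mathbb{R}\cup\{+\infty\}$. For a $d$-dimensional rational polyhedron $Q$, $U(Q)$ is the set of all $u\in\mathbb{Z}^d\setminus\{o\}$ with relatively prime components such that $u$ is an outer normal to a facet of $Q$, and the max-facet-width is $\operatorname{maxfw}(Q)=\max\{w(Q,u):u\in U(Q)\}$. $\operatorname{aff}(F)$ is the affine hull of $F$, and $\ell X=\{\ell x:x\in X\}$. *)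

(* Defs.v *)
From HB Require Import structures.
From mathcomp Require Import all_boot all_order all_algebra.
From mathcomp Require Import all_classical all_reals all_analysis.

Set Implicit Arguments.
Unset Strict Implicit.
Unset Printing Implicit Defensive.

Import Order.TTheory GRing.Theory Num.Theory.
Import numFieldNormedType.Exports.

Local Open Scope classical_set_scope.
Local Open Scope ring_scope.

Definition dotr (R : realType) (d : nat) (u v : 'rV[R]_d) : R :=
  \sum_(i < d) u 0 i * v 0 i.

Definition rational_polyhedron (R : realType) (d : nat) (Q : set 'rV[R]_d) :
    Prop :=
  exists (n : nat) (a : 'I_n -> 'rV[rat]_d) (alpha : 'I_n -> rat),
    (forall i, a i != 0) /\
    Q = [set x | forall i, dotr x (map_mx ratr (a i)) <= ratr (alpha i)].

Definition conv_hull (R : realType) (d : nat) (A : set 'rV[R]_d) :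
    set 'rV[R]_d :=
  smallest (@convex_set R 'rV[R]_d) A.

Definition affine_set (R : realType) (d : nat) (A : set 'rV[R]_d) : Prop :=
  forall (x y : 'rV[R]_d) (t : R), A x -> A y -> A (t *: x + (1 - t) *: y).

Definition aff_hull (R : realType) (d : nat) (A : set 'rV[R]_d) :
    set 'rV[R]_d :=
  smallest (@affine_set R d) A.

(* The affine hull is a translate of an m-dimensional linear subspace; in
   particular the empty set has no dimension in this sense. *)
Definition has_dim (R : realType) (d : nat) (A : set 'rV[R]_d) (m : nat) :
    Prop :=
  exists (x : 'rV[R]_d) (V : {vspace 'rV[R]_d}),
    aff_hull A = [set x + v | v in [set` V]] /\ \dim V = m.

(* Each of the two operators below is meant for d-dimensional closed convex
   sets L; the second one for a nonempty class calL. *)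
Definition R_op (R : realType) (d : nat) (L K : set 'rV[R]_d) : set 'rV[R]_d :=
  conv_hull (K `\` interior L).

Definition R_class (R : realType) (d : nat) (calL : set (set 'rV[R]_d))
    (K : set 'rV[R]_d) : set 'rV[R]_d :=
  \bigcap_(L in calL) R_op L K.

Definition width (R : realType) (d : nat) (K : set 'rV[R]_d) (u : 'rV[R]_d) :
    \bar R :=
  (ereal_sup [set (dotr u x)%:E | x in K] -
   ereal_inf [set (dotr u x)%:E | x in K])%E.

(* Exposed face in direction u: the points of Q where <u, .> is maximal. *)
Definition face_in (R : realType) (d : nat) (Q : set 'rV[R]_d)
    (u : 'rV[R]_d) : set 'rV[R]_d :=
  [set x | Q x /\ forall y, Q y -> dotr u y <= dotr u x].

(* Meant for F a facet of a d-dimensional polyhedron Q: then F = face_in Q u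
   is the same as F being contained in face_in Q u. *)
Definition outer_normal (R : realType) (d : nat) (Q F : set 'rV[R]_d)
    (u : 'rV[R]_d) : Prop :=
  u != 0 /\ F = face_in Q u.

Definition is_facet (R : realType) (d : nat) (Q F : set 'rV[R]_d) : Prop :=
  (exists u, outer_normal Q F u) /\ has_dim F d.-1.

Definition facet_normals (R : realType) (d : nat) (Q : set 'rV[R]_d) :
    set 'rV[int]_d :=
  [set z : 'rV[int]_d | [/\ z != 0,
               \big[gcdz/0]_(i < d) z 0 i = 1 &
               exists F, is_facet Q F /\ outer_normal Q F (map_mx intr z)]].

(* A polyhedron has finitely many facets, so this supremum is a maximum unless
   there is no facet (Q the whole space), in which case it is -oo. *)
Definition maxfw (R : realType) (d : nat) (Q : set 'rV[R]_d) : \bar R :=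
  ereal_sup [set width Q (map_mx intr z) | z in facet_normals Q].

Definition Zlattice (R : realType) (d : nat) : set 'rV[R]_d :=
  [set map_mx intr z | z in [set: 'rV[int]_d]].

(* Main.v *)
Require Import Defs.
From HB Require Import structures.
From mathcomp Require Import all_boot all_order all_algebra.
From mathcomp Require Import all_classical all_reals all_analysis.
From mathcomp Require Import zify ring lra.

Import Order.TTheory GRing.Theory Num.Theory.
Import numFieldNormedType.Exports.

Local Open Scope classical_set_scope.
Local Open Scope ring_scope.

(** The map x |-> (x, 1) turns rational polyhedra in dimension d into slices
at height one of cones in dimension d + 1 generated by finitely many integer
vectors: generators of positive height stand for points and generators of
height zero for recession directions. By the Minkowski theorem
([int_polar_generated]) P is the slice of the cone over some finite family Gam.

A polyhedron L of the class is the intersection of the halfspaces of its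
facets ([irredundant_description], [irredundant_facet]); these have primitive
integer normals z_i and right-hand sides beta_i. By [cond_b] the numbers l * beta_i
are integers, so f_i = (l z_i, - l beta_i) is an integer linear form, and the
interior of L consists of the x with f_i (x, 1) < 0 for all i. By [cond_a] an
integer vector g of positive height on which all f_i are negative satisfies
1 <= - f_i(g) <= l k height(g) ([lattice_description]).

Let g be a generator in the interior of L and h any generator. Moving from h
in the direction g, one enters the interior after
sigma(g, h) = max (0, max_i f_i(h) / - f_i(g)) steps. The set R_L(P) is the
slice of the cone over the rays of Gam, the generators outside the interior of
L, and the crossing vectors h + sigma(g, h) g with sigma(g, h) > 0
([R_op_slice]). The reason is that the part of a cone in a halfspace is
spanned by the generators in this halfspace and by the points where its
boundary separates two generators ([cone_halfspace_sub]); bounded width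
ensures moreover that R_L(P) is closed under moving in the recession directions
of P ([R_op_recession]).

All denominators - f_i(g) are integers between 1 and l k T, where T is the
maximal height in Gam, so M = (l k T)! makes every M sigma(g, h) a natural
number. Thus R_L(P) is determined by finitely many natural numbers: the
indicators of the generators that lie outside the interior, and the numbers
M sigma(g, h). It grows with each of them ([cut_gens_le]), and by Dickson's
lemma ([dickson]) finitely many L realize all minimal values. This is the first
claim, and the second one follows at once. As the crossing vectors
M h + (M sigma) g are integral, the Weyl theorem ([int_cone_polar]) makes every
R_L(P) a rational polyhedron, and the closure of P is a finite intersection of
such sets. *)

(** * Convex cones and halfspaces *)
Section Cones.
Context {R : realFieldType} {V : lmodType R}.
Implicit Types (A K : set V) (x y g h : V).

Definition convex_cone K :=
  [/\ K 0, forall x y, K x -> K y -> K (x + y) &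
      forall t x, 0 <= t -> K x -> K (t *: x)].

Definition cone_hull A : set V := smallest convex_cone A.

Lemma cone_hull_cone A : convex_cone (cone_hull A).
Proof.
split=> [K [[]] //|x y Kx Ky K AK|t x t0 Kx K AK].
- by have [[_ KD _] _] := AK; apply: KD; [exact: Kx|exact: Ky].
- by have [[_ _ KZ] _] := AK; apply: KZ => //; exact: Kx.
Qed.

Lemma cone_hull0 A : cone_hull A 0.
Proof. by have [] := cone_hull_cone A. Qed.

Lemma cone_hullD A x y : cone_hull A x -> cone_hull A y -> cone_hull A (x + y).
Proof. by have [_ + _] := cone_hull_cone A; apply. Qed.

Lemma cone_hullZ A t x : 0 <= t -> cone_hull A x -> cone_hull A (t *: x).
Proof. by have [_ _] := cone_hull_cone A; apply. Qed.

Lemma sub_cone_hull A x : A x -> cone_hull A x.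
Proof. by move=> Ax; apply: sub_gen_smallest. Qed.

Lemma cone_hull_min A K : convex_cone K -> A `<=` K -> cone_hull A `<=` K.
Proof. exact: smallest_sub. Qed.

Lemma cone_divZ {K} t x : convex_cone K -> 0 < t -> K (t *: x) -> K x.
Proof.
move=> [_ _ KZ] t0 /(KZ t^-1); rewrite invr_ge0 ltW// scalerA mulVf ?gt_eqF//.
by rewrite scale1r; exact.
Qed.

(** The part of a cone on the nonnegative side of a linear form phi is spanned
by generators on that side and by the combinations phi(h) g - phi(g) h, which
lie on the hyperplane phi = 0. Writing x = p + n with p and n spanned by the
generators where phi is nonnegative, resp. negative, the identity
phi(p) x = (phi(p) n - phi(n) p) + (phi(p) + phi(n)) p displays x, since the
first term is bilinear in (p, n) and so reduces to generators. *)
Lemma cone_halfspace_sub A K (phi : {linear V -> R^o}) :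
    convex_cone K ->
    (forall g, A g -> 0 <= phi g -> K g) ->
    (forall g h, A g -> A h -> phi g < 0 -> 0 < phi h ->
       K (phi h *: g - phi g *: h)) ->
  forall x, cone_hull A x -> 0 <= phi x -> K x.
Proof.
move=> Kcone Kpos Kcross.
have [K0 KD KZ] := Kcone.
have phiZ t x : phi (t *: x) = t * phi x by rewrite linearZ.
set Ap := [set g | A g /\ 0 <= phi g]; set An := [set g | A g /\ phi g < 0].
have splitA x : cone_hull A x ->
    exists p n, [/\ cone_hull Ap p, cone_hull An n & x = p + n].
  apply: (@cone_hull_min _
    [set x | exists p n, [/\ cone_hull Ap p, cone_hull An n & x = p + n]]).
    split=> /=.
    - by exists 0, 0; split; rewrite ?addr0//; exact: cone_hull0.
    - move=> _ _ [p [n [Pp Nn ->]]] [p' [n' [Pp' Nn' ->]]].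
      by exists (p + p'), (n + n'); split; rewrite 1?addrACA//; exact: cone_hullD.
    - move=> t _ t0 [p [n [Pp Nn ->]]]; exists (t *: p), (t *: n).
      by split; rewrite ?scalerDr//; exact: cone_hullZ.
  move=> g Ag /=; have [g0|g0] := leP 0 (phi g).
  - exists g, 0; split; rewrite ?addr0//; last exact: cone_hull0.
    exact: sub_cone_hull.
  - exists 0, g; split; rewrite ?add0r//; first exact: cone_hull0.
    exact: sub_cone_hull.
have KAp p : cone_hull Ap p -> K p.
  by apply: cone_hull_min => // g [Ag]; exact: Kpos.
have phi_p p : cone_hull Ap p -> 0 <= phi p.
  apply: (@cone_hull_min _ [set p | 0 <= phi p]) => [|g []//].
  split=> /=[|x y x0 y0|t x t0 x0]; first by rewrite linear0.
  - by rewrite linearD addr_ge0.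
  - by rewrite linearZ mulr_ge0.
have phi_n n : cone_hull An n -> n = 0 \/ phi n < 0.
  apply: (@cone_hull_min _ [set n | n = 0 \/ phi n < 0]) => [|g []]; last by right.
  split=> /=[|x y [->|x0] [->|y0]|t x t0 [->|x0]]; first by left.
  - by left; rewrite addr0.
  - by right; rewrite add0r.
  - by right; rewrite addr0.
  - by right; rewrite linearD -[ltRHS]addr0 ltrD.
  - by left; rewrite scaler0.
  - move: t0; rewrite le_eqVlt => /orP[/eqP<-|t0]; first by left; rewrite scale0r.
    by right; rewrite linearZ pmulr_rlt0.
have cross p n : cone_hull Ap p -> cone_hull An n -> K (phi p *: n - phi n *: p).
  move=> Pp; apply: (@cone_hull_min _ [set n | K (phi p *: n - phi n *: p)]).
    split=> /=[|x y Kx Ky|t x t0 Kx].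
    - by rewrite (linear0 phi) scaler0 scale0r subrr.
    - by rewrite (linearD phi) scalerDl scalerDr opprD addrACA; exact: KD.
    - rewrite phiZ scalerA mulrC -scalerA -[X in _ - X]scalerA -scalerBr.
      exact: KZ.
  move=> g [Ag g0] /=; move: p Pp.
  apply: (@cone_hull_min _ [set p | K (phi p *: g - phi g *: p)]).
    split=> /=[|x y Kx Ky|t x t0 Kx].
    - by rewrite (linear0 phi) scaler0 scale0r subrr.
    - by rewrite (linearD phi) scalerDl scalerDr opprD addrACA; exact: KD.
    - rewrite phiZ -scalerA [X in _ - X]scalerA [X in _ - X *: _]mulrC.
      by rewrite -[X in _ - X]scalerA -scalerBr; exact: KZ.
  move=> h [Ah]; rewrite le_eqVlt => /orP[/eqP h0|h0]; last exact: Kcross.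
  rewrite /= -h0 scale0r sub0r -scaleNr; apply: KZ; first by rewrite oppr_ge0 ltW.
  by apply: Kpos; rewrite // -h0.
move=> x /splitA[p [n [Pp Nn ->]]]; rewrite linearD => pn0.
have := phi_p _ Pp; rewrite le_eqVlt => /orP[/eqP p0|p0].
  have [->|n0] := phi_n _ Nn; first by rewrite addr0; exact: KAp.
  by move: pn0; rewrite -p0 add0r leNgt n0.
apply: (cone_divZ _ _ Kcone p0).
have -> : phi p *: (p + n) = (phi p *: n - phi n *: p) + (phi p + phi n) *: p.
  by rewrite scalerDr scalerDl [RHS]addrACA addNr addr0 addrC.
by apply: KD; [exact: cross|apply: KZ => //; exact: KAp].
Qed.

End Cones.

(** * Finitely generated cones over the integers *)
Section Dot.
Context {n : nat}.

Definition dot {F : pzRingType} (u v : 'rV[F]_n) : F := \sum_i u 0 i * v 0 i.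

Lemma dotDr {F : pzRingType} (u v w : 'rV[F]_n) : dot u (v + w) = dot u v + dot u w.
Proof. by rewrite -big_split; apply: eq_bigr => i _; rewrite mxE mulrDr. Qed.

Lemma dotDl {F : pzRingType} (u v w : 'rV[F]_n) : dot (v + w) u = dot v u + dot w u.
Proof. by rewrite -big_split; apply: eq_bigr => i _; rewrite mxE mulrDl. Qed.

Lemma dotZl {F : pzRingType} a (u v : 'rV[F]_n) : dot (a *: u) v = a * dot u v.
Proof. by rewrite mulr_sumr; apply: eq_bigr => i _; rewrite mxE mulrA. Qed.

Lemma dotC {F : comPzRingType} (u v : 'rV[F]_n) : dot u v = dot v u.
Proof. by apply: eq_bigr => i _; rewrite mulrC. Qed.

Lemma dotZr {F : comPzRingType} a (u v : 'rV[F]_n) : dot u (a *: v) = a * dot u v.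
Proof. by rewrite dotC dotZl dotC. Qed.

Lemma dotNl {F : comPzRingType} (u v : 'rV[F]_n) : dot (- u) v = - dot u v.
Proof. by rewrite -scaleN1r dotZl mulN1r. Qed.

Lemma dot_delta {F : comPzRingType} i (v : 'rV[F]_n) : dot (delta_mx 0 i) v = v 0 i.
Proof.
rewrite /dot (bigD1 i)//= mxE !eqxx mul1r big1 ?addr0// => j ji.
by rewrite mxE (negbTE ji) mul0r.
Qed.

Lemma dot_linear {F : comPzRingType} (u : 'rV[F]_n) :
  linear_for *%R (dot u).
Proof. by move=> a v w; rewrite dotDr dotZr. Qed.

HB.instance Definition _ {F : comPzRingType} (u : 'rV[F]_n) :=
  GRing.isLinear.Build F 'rV[F]_n F *%R (dot u) (dot_linear u).

End Dot.

Notation intv := (map_mx intr).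

Lemma dot_intv {R : pzRingType} {n} (u v : 'rV[int]_n) :
  dot (intv u) (intv v) = (dot u v)%:~R :> R.
Proof. by rewrite rmorph_sum; apply: eq_bigr => i _; rewrite !mxE rmorphM. Qed.

Section Weyl.
Context {R : realFieldType} {n : nat}.
Implicit Types (A G : seq 'rV[int]_n).

(** Generators and inequalities are kept integral, which records rationality
while the cones themselves live in a real space. *)
Definition int_cone G : set 'rV[R]_n :=
  cone_hull [set intv g | g in [set` G]].

Definition int_polar A : set 'rV[R]_n :=
  [set x | forall a, a \in A -> dot (intv a) x <= 0].

Lemma int_polar_cone A : convex_cone (int_polar A).
Proof.
split=> [a aA|x y Kx Ky a aA|t x t0 Kx a aA]; first by rewrite linear0.
- by rewrite linearD /=; apply: (le_trans (lerD (Kx a aA) (Ky a aA))); rewrite addr0.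
- by rewrite linearZ mulr_ge0_le0 //; exact: Kx.
Qed.

Lemma mem_int_cone G g : g \in G -> int_cone G (intv g).
Proof. by move=> gG; apply: sub_cone_hull; exists g. Qed.

Lemma int_cone_min G (K : set 'rV[R]_n) :
  convex_cone K -> (forall g, g \in G -> K (intv g)) -> int_cone G `<=` K.
Proof. by move=> Kc GK; apply: cone_hull_min => // _ [g gG <-]; exact: GK. Qed.

(** Weyl's theorem, by Fourier-Motzkin elimination: x lies in the cone over
g :: G when x - t g lies in the cone over G for some t >= 0. Each inequality a
of the latter cone bounds t from below or above according to the sign of
<a, g>, and such a t exists if and only if every lower bound is at most every
upper bound; cleared of denominators, these comparisons are again integral. *)
Theorem int_cone_polar G : exists A, int_cone G = int_polar A.
Proof.
elim: G => [|g G [A GA]].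
  exists ([seq delta_mx 0 i | i : 'I_n] ++ [seq - delta_mx 0 i | i : 'I_n]).
  apply/seteqP; split; first by apply: int_cone_min => //; exact: int_polar_cone.
  move=> x xA; suff -> : x = 0 by exact: cone_hull0.
  apply/rowP => i; rewrite mxE; apply/eqP; rewrite eq_le; apply/andP; split.
    have /xA : delta_mx 0 i \in
        [seq delta_mx 0 i | i : 'I_n] ++ [seq (- delta_mx 0 i : 'rV[int]_n) | i : 'I_n].
      by rewrite mem_cat map_f ?mem_enum.
    by rewrite map_delta_mx dot_delta.
  have /xA : - delta_mx 0 i \in
      [seq delta_mx 0 i | i : 'I_n] ++ [seq (- delta_mx 0 i : 'rV[int]_n) | i : 'I_n].
    by rewrite mem_cat orbC (map_f (fun j => - delta_mx 0 j)) ?mem_enum.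
  by rewrite map_mxN map_delta_mx dotNl dot_delta oppr_le0.
pose A0 := [seq a <- A | dot a g <= 0].
pose Apos := [seq a <- A | 0 < dot a g]; pose Aneg := [seq a <- A | dot a g < 0].
(* the pairs express that the lower bound for t given by a is at most the
   upper bound given by b *)
exists (A0 ++ [seq dot a g *: b - dot b g *: a | a <- Apos, b <- Aneg]).
set A' := (X in int_polar X).
have A0P a : a \in A -> dot a g <= 0 -> a \in A'.
  by move=> aA ag; rewrite mem_cat mem_filter ag aA.
have A'P a b : a \in A -> b \in A -> 0 < dot a g -> dot b g < 0 ->
    dot a g *: b - dot b g *: a \in A'.
  move=> aA bA ag bg; rewrite mem_cat; apply/orP; right.
  by apply/allpairsP; exists (a, b); split; rewrite //= mem_filter ?ag ?bg.
have intvE (a b : 'rV[int]_n) (x : 'rV[R]_n) :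
    dot (intv (dot a g *: b - dot b g *: a)) x =
    (dot a g)%:~R * dot (intv b) x - (dot b g)%:~R * dot (intv a) x.
  by rewrite map_mxB !map_mxZ dotDl dotNl !dotZl.
apply/seteqP; split.
  apply: int_cone_min; first exact: int_polar_cone.
  move=> h; rewrite in_cons => hgG a; rewrite mem_cat => /orP[|].
    rewrite mem_filter => /andP[ag aA]; move: hgG => /orP[/eqP ->|hG].
      by rewrite dot_intv lerz0.
    by have := mem_int_cone G h hG; rewrite GA; apply.
  move=> /allpairsP[[b c] /= []]; rewrite !mem_filter.
  move=> /andP[bg bA] /andP[cg cA] ->; rewrite intvE.
  move: hgG => /orP[/eqP ->|hG].
    by rewrite !dot_intv mulrC subrr.
  have := mem_int_cone G h hG; rewrite GA => hA.
  have := hA _ bA; have := hA _ cA.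
  rewrite -(ltr0z R) in bg; rewrite -(ltrz0 R) in cg.
  by move=> hc hb; rewrite subr_le0; nra.
move=> x xA'.
pose t : R := \big[Num.max/0]_(a <- A | 0 < dot a g) (dot (intv a) x / (dot a g)%:~R).
have t0 : 0 <= t by apply: bigmax_ge_id.
rewrite -[x](subrK (t *: intv g)); apply: cone_hullD; last first.
  by apply: cone_hullZ => //; apply: mem_int_cone; rewrite mem_head.
have : int_polar A (x - t *: intv g).
  move=> a aA; rewrite linearB linearZ /= dot_intv subr_le0.
  have [ag|ag|ag] := ltgtP 0 (dot a g).
  - rewrite -ler_pdivrMr ?ltr0z//.
    exact: (le_bigmax_seq _ a (fun a => 0 < dot a g)
      (fun a => dot (intv a) x / (dot a g)%:~R)).
  - (* an upper bound for t: compare with 0 and with every lower bound *)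
    rewrite -ler_ndivlMr ?ltrz0// /t big_seq_cond.
    apply: bigmax_le => [|b /andP[bA bg]].
      by rewrite ler_ndivlMr ?ltrz0// mul0r; apply: xA'; apply: A0P => //; rewrite ltW.
    have := xA' _ (A'P b a bA aA bg ag); rewrite intvE subr_le0 => cross.
    rewrite ler_ndivlMr ?ltrz0// mulrAC ler_pdivlMr ?ltr0z//.
    by rewrite mulrC [leRHS]mulrC.
  - by rewrite -ag mulr0; apply: xA'; apply: A0P; rewrite // -ag.
rewrite -GA; apply: int_cone_min; first exact: cone_hull_cone.
by move=> h hG; apply: mem_int_cone; rewrite in_cons hG orbT.
Qed.

(** Minkowski's theorem is dual to Weyl's: if the polar of cone A is cut out by
G, then the polar of A is spanned by G. *)
Theorem int_polar_generated A : exists G, int_polar A = int_cone G.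
Proof.
have [G AG] := int_cone_polar A; exists G.
have [D GD] := int_cone_polar G.
apply/seteqP; split=> [x xA|].
  rewrite GD => c cD.
  suff : int_cone A (intv c).
    apply: (@int_cone_min A [set y | dot y x <= 0]) => //.
    split=> /=[|y z y0 z0|t y t0 y0].
    - by rewrite dotC linear0.
    - by rewrite dotDl -[leRHS]addr0 lerD.
    - by rewrite dotZl mulr_ge0_le0.
  rewrite AG => g gG; rewrite dotC.
  by have := mem_int_cone _ _ gG; rewrite GD; apply.
apply: int_cone_min; first exact: int_polar_cone.
move=> g gG a aA; rewrite dotC.
by have := mem_int_cone _ _ aA; rewrite AG; apply.
Qed.

End Weyl.

(** * Homogenization *)
Section Homogenization.
Context {F : comPzRingType} {d : nat}.
Implicit Types (x z : 'rV[F]_d) (y : 'rV[F]_(d + 1)).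

Definition hom_pt x c : 'rV[F]_(d + 1) := row_mx x c%:M.

Definition base y : 'rV[F]_d := lsubmx y.
Definition height y : F := y 0 (rshift d ord0).

Lemma dot_hom x z (a c : F) : dot (hom_pt z a) (hom_pt x c) = dot z x + a * c.
Proof.
rewrite /dot big_split_ord /= big_ord1; congr (_ + _).
  by apply: eq_bigr => i _; rewrite !row_mxEl.
by rewrite !row_mxEr !mxE !eqxx.
Qed.

Lemma base_hom x c : base (hom_pt x c) = x.
Proof. by rewrite /base row_mxKl. Qed.

Lemma height_hom x c : height (hom_pt x c) = c.
Proof. by rewrite /height row_mxEr mxE eqxx. Qed.

Lemma homK y : hom_pt (base y) (height y) = y.
Proof.
rewrite -[RHS]hsubmxK /hom_pt; congr row_mx.
by apply/rowP => i; rewrite !mxE (ord1 i) eqxx.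
Qed.

Lemma hom_ptD x x' c c' : hom_pt (x + x') (c + c') = hom_pt x c + hom_pt x' c'.
Proof. by rewrite /hom_pt raddfD add_row_mx. Qed.

Lemma hom_ptZ t x c : hom_pt (t *: x) (t * c) = t *: hom_pt x c.
Proof. by rewrite /hom_pt scale_row_mx scale_scalar_mx. Qed.

Lemma heightD y y' : height (y + y') = height y + height y'.
Proof. by rewrite /height mxE. Qed.

Lemma heightZ t y : height (t *: y) = t * height y.
Proof. by rewrite /height mxE. Qed.

Lemma dotE y y' : dot y y' = dot (base y) (base y') + height y * height y'.
Proof. by rewrite -{1}(homK y) -{1}(homK y') dot_hom. Qed.

End Homogenization.

Lemma height_intv {R : comPzRingType} {d} (y : 'rV[int]_(d + 1)) :
  height (intv y) = (height y)%:~R :> R.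
Proof. by rewrite /height mxE. Qed.

Lemma base_intv {R : comPzRingType} {d} (y : 'rV[int]_(d + 1)) :
  base (intv y) = intv (base y) :> 'rV[R]_d.
Proof. by apply/rowP => i; rewrite !mxE. Qed.

Lemma hom_intv {R : comPzRingType} {d} (z : 'rV[int]_d) c :
  intv (hom_pt z c) = hom_pt (intv z) c%:~R :> 'rV[R]_(d + 1).
Proof. by rewrite -[RHS]homK -[LHS]homK base_intv height_intv !base_hom !height_hom. Qed.

Lemma clear_denominators {n} (q : 'rV[rat]_n) :
  exists (D : nat) (z : 'rV[int]_n), (0 < D)%N /\ D%:R *: q = intv z.
Proof.
pose D := (\prod_i `|denq (q 0%R i)|)%N.
exists D, (\row_i (numq (q 0 i) * (\prod_(j | j != i) `|denq (q 0%R j)|)%N%:Z)); split.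
  by rewrite prodn_gt0 // => i; rewrite absz_gt0 denq_neq0.
apply/rowP => i; rewrite !mxE /D (bigD1 i) //= natrM rmorphM /= numqE.
have -> : (denq (q 0 i))%:~R = `|denq (q 0%R i)|%N%:R :> rat.
  by rewrite -[in LHS]absz_denq.
by rewrite mulrC [in RHS]mulrC mulrA -pmulrn mulrCA mulrA mulrAC.
Qed.

(** * Rational polyhedra *)
Lemma dotrE {R : realType} {d} (u v : 'rV[R]_d) : dotr u v = dot u v.
Proof. by []. Qed.

Section RationalPolyhedra.
Context {R : realType} {d : nat}.
Implicit Types (A : seq 'rV[int]_(d + 1)) (Q : set 'rV[R]_d).

Definition slice (K : set 'rV[R]_(d + 1)) : set 'rV[R]_d :=
  [set x | K (hom_pt x 1)].

Lemma rational_polyhedron_slice Q : rational_polyhedron Q ->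
  exists A, Q = slice (int_polar A).
Proof.
move=> [n [a [alpha [_ ->]]]].
have /choice[w wP] i : exists w : 'rV[int]_(d + 1),
    exists2 D : nat, (0 < D)%N & intv w = D%:R *: hom_pt (a i) (- alpha i).
  by have [D [z [D0 zE]]] := clear_denominators (hom_pt (a i) (- alpha i));
     exists z, D.
exists [seq w i | i : 'I_n].
have wE i (x : 'rV[R]_d) : (dot (intv (w i)) (hom_pt x 1) <= 0) =
    (dotr x (map_mx ratr (a i)) <= ratr (alpha i)).
  have [D D0 wD] := wP i.
  have -> : intv (w i) = D%:R *: hom_pt (map_mx ratr (a i)) (- ratr (alpha i)) :> 'rV[R]__.
    have -> : intv (w i) = map_mx ratr (intv (w i) : 'rV[rat]__) :> 'rV[R]__.
      by apply/matrixP => r s; rewrite !mxE ratr_int.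
    rewrite wD map_mxZ. rewrite rmorph_nat; congr (_ *: _).
    by rewrite /hom_pt map_row_mx map_scalar_mx /= rmorphN.
  rewrite dotZl pmulr_rle0 ?ltr0n// dot_hom mulr1 subr_le0.
  by rewrite dotrE dotC.
apply/seteqP; split=> [x xa _ /mapP[i _ ->]|x xw i]; first by rewrite wE.
by rewrite -wE; apply: xw; rewrite map_f// mem_enum.
Qed.

Lemma rational_polyhedron0 : (0 < d)%N -> @rational_polyhedron R d set0.
Proof.
case: d => // d' _.
exists 2%N, (fun i => (-1) ^+ i *: delta_mx 0 ord0), (fun=> -1); split.
  move=> i; rewrite scaler_eq0 signr_eq0 /=; apply/eqP => /rowP/(_ ord0)/eqP.
  by rewrite !mxE !eqxx oner_eq0.
apply/seteqP; split=> // x /= xP.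
have dE (i : 'I_2) : dotr x (map_mx ratr ((-1) ^+ i *: delta_mx 0 ord0)) =
    (-1) ^+ i * x 0 ord0.
  rewrite dotrE dotC map_mxZ dotZl map_delta_mx dot_delta.
  by rewrite rmorphXn rmorphN1.
have := xP 0; have := xP 1; rewrite !dE /= expr0 expr1 rmorphN1.
lra.
Qed.

Lemma slice_rational_polyhedron A : (0 < d)%N ->
  rational_polyhedron (slice (int_polar A)).
Proof.
move=> d0.
(* A row with zero base reads height a <= 0: either it is trivial, or it makes
   the slice empty; in both cases it has to be replaced by proper halfspaces. *)
have [/hasP[a aA /andP[/eqP a0 ah]]|noA] :=
    boolP (has (fun a => (base a == 0) && (0 < height a)) A).
  suff -> : slice (int_polar A) = set0 by exact: rational_polyhedron0.
  apply/seteqP; split=> // x /(_ a aA).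
  rewrite dotE base_intv a0 height_intv height_hom mulr1 map_mx0 dotC linear0.
  by rewrite add0r lerz0 leNgt ah.
pose B := [seq a <- A | base a != 0].
exists (size B), (fun i => intv (base (nth 0 B i))),
  (fun i => - (height (nth 0 B i))%:~R); split.
  move=> i; have := mem_nth 0 (ltn_ord i); rewrite mem_filter => /andP[+ _].
  apply: contraNneq => /rowP b0; apply/eqP/rowP => j.
  by have := b0 j; rewrite !mxE => /eqP; rewrite intr_eq0 => /eqP.
have rowE a (x : 'rV[R]_d) : (dot (intv a) (hom_pt x 1) <= 0) =
    (dotr x (map_mx ratr (intv (base a))) <= ratr (- (height a)%:~R)).
  rewrite dotE base_intv base_hom height_intv height_hom mulr1 -lerBrDr sub0r.
  rewrite rmorphN /= ratr_int dotrE dotC; congr (dot _ _ <= _).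
  by apply/rowP => j; rewrite !mxE ratr_int.
apply/seteqP; split=> [x xA i|x xB a aA].
  rewrite -rowE; apply: xA.
  by have := mem_nth 0 (ltn_ord i); rewrite mem_filter => /andP[].
have [a0|a0] := eqVneq (base a) 0.
  rewrite dotE base_intv a0 map_mx0 dotC linear0 add0r height_intv height_hom mulr1.
  rewrite lerz0 leNgt; apply: contra noA => ah.
  by apply/hasP; exists a; rewrite // a0 eqxx.
have aB : a \in B by rewrite mem_filter a0.
rewrite rowE -(nth_index 0 aB); rewrite -index_mem in aB.
exact: (xB (Ordinal aB)).
Qed.

Lemma rational_polyhedronI Q1 Q2 : (0 < d)%N -> rational_polyhedron Q1 ->
  rational_polyhedron Q2 -> rational_polyhedron (Q1 `&` Q2).
Proof.
move=> d0 /rational_polyhedron_slice[A ->] /rational_polyhedron_slice[B ->].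
have -> : slice (int_polar A) `&` slice (int_polar B) = slice (int_polar (A ++ B)).
  apply/seteqP; split=> [x [xA xB] a|x xAB].
    by rewrite mem_cat => /orP[]; [exact: xA|exact: xB].
  by split=> a aA; apply: xAB; rewrite mem_cat aA ?orbT.
exact: slice_rational_polyhedron.
Qed.

Lemma rational_polyhedronT : @rational_polyhedron R d setT.
Proof.
exists 0%N, (fun i => 0), (fun=> 0); split; first by case.
by apply/seteqP; split=> // x _ [].
Qed.

Lemma rational_polyhedron_bigcap {T : choiceType} (D : set T) (f : T -> set 'rV[R]_d) :
  (0 < d)%N -> finite_set D -> (forall i, D i -> rational_polyhedron (f i)) ->
  rational_polyhedron (\bigcap_(i in D) f i).
Proof.
move=> d0 /finite_seqP[s ->]; elim: s => [_|i s IHs fP].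
  rewrite (_ : \bigcap_(_ in _) _ = setT); first exact: rational_polyhedronT.
  by apply/seteqP; split.
rewrite (_ : \bigcap_(j in [set` i :: s]) f j = f i `&` \bigcap_(j in [set` s]) f j).
  apply: rational_polyhedronI => //; first by apply: fP; rewrite /= mem_head.
  by apply: IHs => j js; apply: fP; rewrite /= in_cons js orbT.
apply/seteqP; split=> [x xP|x [xi xs] j /=].
  split=> [|j js]; first by apply: xP; rewrite /= mem_head.
  by apply: xP; rewrite /= in_cons js orbT.
by rewrite in_cons => /orP[/eqP->|js] //; exact: xs.
Qed.

End RationalPolyhedra.

(** * Convex hulls and slices *)
Lemma convex_setE {R : realType} {d} (A : set 'rV[R]_d) :
  @convex_set R 'rV[R]_d A <->
  forall x y t, A x -> A y -> 0 <= t -> t <= 1 -> A (t *: x + (1 - t) *: y).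
Proof.
split=> [cA x y t Ax Ay t0 t1|cA x y t].
  by have := cA x y (Itv01 t0 t1) (mem_set Ax) (mem_set Ay); rewrite inE.
by rewrite !inE => Ax Ay; apply: cA.
Qed.

Section ConvHull.
Context {R : realType} {d : nat}.
Implicit Types (A : set 'rV[R]_d).

Lemma conv_hull_convex A x y t : conv_hull A x -> conv_hull A y -> 0 <= t -> t <= 1 ->
  conv_hull A (t *: x + (1 - t) *: y).
Proof.
move=> Ax Ay t0 t1 K [Kc AK]; have /convex_setE := Kc; apply=> //.
  exact: Ax.
exact: Ay.
Qed.

Lemma conv_hull_min A K :
  (forall x y t, K x -> K y -> 0 <= t -> t <= 1 -> K (t *: x + (1 - t) *: y)) ->
  A `<=` K -> conv_hull A `<=` K.
Proof. by move=> /convex_setE Kc; apply: smallest_sub. Qed.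

End ConvHull.

Lemma slice_cone_convex {R : realType} {d} (K : set 'rV[R]_(d + 1)) x y t :
  convex_cone K -> slice K x -> slice K y -> 0 <= t -> t <= 1 ->
  slice K (t *: x + (1 - t) *: y).
Proof.
move=> [_ KD KZ] Kx Ky t0 t1; rewrite /slice /=.
have -> : hom_pt (t *: x + (1 - t) *: y) 1 = t *: hom_pt x 1 + (1 - t) *: hom_pt y 1.
  by rewrite -!hom_ptZ -hom_ptD !mulr1 subrKC.
by apply: KD; apply: KZ; rewrite ?subr_ge0.
Qed.

(** * Crossing vectors *)
Section Cuts.
Context {R : realType} {d : nat}.
Implicit Types (L : set 'rV[R]_d) (fs : seq 'rV[int]_(d + 1)) (f g h : 'rV[int]_(d + 1)).

Definition inside fs g := all (fun f => dot f g < 0) fs.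

(** The members of fs are the forms of the facets of L, multiplied by a common
denominator of the right-hand sides. Bounded max-facet-width enters through the
last two clauses: the slack of an integer vector inside L is at most b times
its height, and every recession direction of L is a lineality direction. *)
Definition bounded_description b fs L :=
  [/\ interior L = [set x | forall f, f \in fs -> dot (intv f) (hom_pt x 1) < 0],
      forall f g, f \in fs -> 0 < height g -> inside fs g -> - dot f g <= b * height g &
      forall c : 'rV[R]_(d + 1), height c = 0 ->
        (forall f, f \in fs -> dot (intv f) c <= 0) ->
        forall f, f \in fs -> dot (intv f) c = 0].

(** The number s / M is the parameter sigma = max (0, max_f f(h) / - f(g)) at
which h + sigma g enters the interior. *)
Definition crossing (M : nat) fs g h (s : nat) :=
  (forall f, f \in fs -> M%:Z * dot f h + s%:Z * dot f g <= 0) /\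
  ((0 < s)%N -> exists2 f, f \in fs & M%:Z * dot f h + s%:Z * dot f g = 0).

(** Divisibility is what makes the least admissible s exact: M f(h) + s f(g) is
a multiple of f(g), so it is positive for s - 1 and nonpositive for s only if
it vanishes for s. *)
Lemma crossing_exists (M : nat) fs g h : inside fs g ->
    (forall f, f \in fs -> (dot f g %| M%:Z)%Z) ->
  exists s, crossing M fs g h s.
Proof.
move=> /allP gin Mdiv.
pose ok s := all (fun f => M%:Z * dot f h + s%:Z * dot f g <= 0) fs.
have ex_ok : exists s, ok s.
  exists (\max_(f <- fs) `|(M%:Z * dot f h : int)|)%N; apply/allP => f ffs.
  set s := (\max_(_ <- _) _)%N.
  have : (`|(M%:Z * dot f h : int)| <= s)%N by apply: (@leq_bigmax_seq _ fs xpredT).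
  have := gin f ffs; move: (dot f g) (M%:Z * dot f h) => u v; nia.
exists (ex_minn ex_ok); case: ex_minnP => s /allP oks smin; split=> // s0.
have : ~~ ok s.-1 by apply: contraTN s0 => /smin; case: (s) => // n; rewrite ltnn.
move=> /allPn[f ffs fs1]; exists f => //.
have := oks f ffs; have /dvdzP[q Mq] := Mdiv f ffs; have := gin f ffs.
move: fs1; rewrite Mq; case: s s0 {oks smin} => // s _ /=.
move: (dot f g) (dot f h) => u v; rewrite -ltNge.
move=> s1 u0 s2.
have : (q * v + s%:Z) * u > 0 by rewrite mulrDl mulrAC.
rewrite nmulr_lgt0 // => qs.
have : (q * v + s.+1%:Z) * u <= 0 by rewrite mulrDl mulrAC.
rewrite nmulr_lle0 // => qs'.
have -> : q * u * v + s.+1%:Z * u = (q * v + s.+1%:Z) * u by ring.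
suff -> : q * v + s.+1%:Z = 0 by rewrite mul0r.
lia.
Qed.

(** Rays are kept in all cases, as R_L(P) is closed under moving in the recession
directions of P; the crossing vectors h + (s / M) g are scaled by M to be integral. *)
Definition cut_gens (Gam : seq 'rV[int]_(d + 1)) (M : nat) fs
    (s : 'rV[int]_(d + 1) -> 'rV[int]_(d + 1) -> nat) :=
  [seq g <- Gam | (height g == 0) || ~~ inside fs g] ++
  [seq M%:Z *: h + (s g h)%:Z *: g |
     g <- [seq g <- Gam | (height g != 0) && inside fs g],
     h <- [seq h <- Gam | (0 < s g h)%N]].

Section CutGens.
Variables (Gam : seq 'rV[int]_(d + 1)) (M : nat) (fs : seq 'rV[int]_(d + 1)).
Variable (s : 'rV[int]_(d + 1) -> 'rV[int]_(d + 1) -> nat).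
Local Notation cone := (@int_cone R (d + 1) (cut_gens Gam M fs s)).

Lemma cut_gens_keep g : g \in Gam -> (height g == 0) || ~~ inside fs g ->
  cone (intv g).
Proof.
by move=> gG gout; apply: mem_int_cone; rewrite mem_cat mem_filter gout gG.
Qed.

Lemma cut_gens_cross g h : g \in Gam -> h \in Gam -> height g != 0 ->
  inside fs g -> (0 < s g h)%N -> cone (M%:R *: intv h + (s g h)%:R *: intv g).
Proof.
move=> gG hG g0 gin sgh.
have -> : M%:R *: intv h + (s g h)%:R *: intv g =
    intv (M%:Z *: h + (s g h)%:Z *: g) :> 'rV[R]_(d + 1).
  by rewrite map_mxD !map_mxZ.
apply: mem_int_cone; rewrite mem_cat; apply/orP; right.
apply/allpairsPdep; exists g, h.
by rewrite !mem_filter g0 gin gG sgh hG.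
Qed.

Lemma cut_gens_min (K : set 'rV[R]_(d + 1)) : convex_cone K ->
    (forall g, g \in Gam -> (height g == 0) || ~~ inside fs g -> K (intv g)) ->
    (forall g h, g \in Gam -> h \in Gam -> height g != 0 -> inside fs g ->
       (0 < s g h)%N -> K (M%:R *: intv h + (s g h)%:R *: intv g)) ->
  cone `<=` K.
Proof.
move=> Kcone Kkeep Kcross; apply: int_cone_min => // y; rewrite mem_cat.
move=> /orP[|/allpairsPdep[g [h []]]].
  by rewrite mem_filter => /andP[gout gG]; exact: Kkeep.
rewrite !mem_filter => /andP[/andP[g0 gin] gG] /andP[sgh hG] ->.
by rewrite map_mxD !map_mxZ; exact: Kcross.
Qed.

End CutGens.

(** A smaller crossing parameter means a crossing vector deeper on the side of
h, namely a combination of h and of the crossing vector with the larger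
parameter; and h itself is outside as soon as the parameter is positive. *)
Lemma cut_gens_le Gam (M : nat) fs fs' s s' : (0 < M)%N ->
    (forall g h, g \in Gam -> h \in Gam -> height g != 0 -> inside fs' g ->
       crossing M fs' g h (s' g h)) ->
    (forall g, g \in Gam -> inside fs g -> inside fs' g) ->
    (forall g h, g \in Gam -> h \in Gam -> (s' g h <= s g h)%N) ->
  int_cone (cut_gens Gam M fs' s') `<=` @int_cone R (d + 1) (cut_gens Gam M fs s).
Proof.
move=> M0 s'P in_le s_le.
have keep g : g \in Gam -> (height g == 0) || ~~ inside fs' g ->
    int_cone (cut_gens Gam M fs s) (intv g : 'rV[R]__).
  move=> gG /orP[g0|gout]; apply: cut_gens_keep; rewrite ?g0 //.
  by rewrite (contra (in_le g gG)) ?orbT.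
apply: cut_gens_min => [|//|g h gG hG g0 gin' sgh'].
  exact: cone_hull_cone.
have [_ /(_ sgh')[f ffs fcross]] := s'P g h gG hG g0 gin'.
(* s' g h > 0 forces f h > 0 at the form f attaining the crossing *)
have hcone : int_cone (cut_gens Gam M fs s) (intv h : 'rV[R]__).
  apply: keep => //; apply/orP; right; apply/allPn; exists f => //.
  have := allP gin' f ffs; move: fcross sgh' M0; rewrite -leNgt.
  move: (s' g h) (dot f g) (dot f h) => t u v; nia.
have [gin|gout] := boolP (inside fs g); last first.
  apply: cone_hullD; apply: cone_hullZ; rewrite ?ler0n//.
  by apply: cut_gens_keep => //; rewrite gout orbT.
have sgh : (0 < s g h)%N by exact: leq_trans sgh' (s_le _ _ gG hG).
have := cut_gens_cross Gam M fs s g h gG hG g0 gin sgh.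
set e := _ + _ => econe.
have s0 : (0 : R) < (s g h)%:R by rewrite ltr0n.
have sE : M%:R *: intv h + (s' g h)%:R *: intv g =
    ((s' g h)%:R / (s g h)%:R) *: e +
    ((1 - (s' g h)%:R / (s g h)%:R) * M%:R) *: intv h :> 'rV[R]_(d + 1).
  rewrite /e scalerDr !scalerA addrAC -scalerDl -mulrDl subrKC mul1r.
  by rewrite divfK ?gt_eqF//.
rewrite sE; apply: cone_hullD; apply: cone_hullZ => //.
rewrite mulr_ge0 // subr_ge0 ler_pdivrMr // mul1r ler_nat; exact: s_le.
Qed.

End Cuts.

(** * The set R_L(P) as a slice of a finitely generated cone *)
Section Representation.
Context {R : realType} {d : nat}.
Variables (Gam : seq 'rV[int]_(d + 1)) (b : int) (fs : seq 'rV[int]_(d + 1)).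
Variables (L : set 'rV[R]_d).
Hypothesis LP : bounded_description b fs L.
Let P : set 'rV[R]_d := slice (int_cone Gam).

Lemma not_interiorP x :
  ~ interior L x <-> exists2 f, f \in fs & 0 <= dot (intv f) (hom_pt x 1).
Proof.
have [-> _ _] := LP; split=> [/existsNP[f /not_implyP[ffs fx]]|[f ffs fx] /(_ f ffs)].
  by exists f => //; rewrite leNgt; apply/negP.
by rewrite ltNge fx.
Qed.

Lemma slice_cone_add x (c : 'rV[R]_(d + 1)) :
  P x -> int_cone Gam c -> height c = 0 -> P (x + base c).
Proof.
move=> Px Gc c0; rewrite /P /slice /= -[1](addr0) hom_ptD -c0 homK.
exact: cone_hullD.
Qed.

(** If moving from a point outside L in the direction c could enter L for good,
all forms would be nonpositive on c, hence zero by bounded width. Otherwise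
some form is positive on c, the ray leaves the interior of L again far away,
and x + c is between x and such a far point. *)
Lemma R_op_recession x (c : 'rV[R]_(d + 1)) :
  int_cone Gam c -> height c = 0 -> R_op L P x -> R_op L P (x + base c).
Proof.
move=> Gc c0; move: x; apply: (@conv_hull_min _ _ _ [set x | R_op L P (x + base c)]).
  move=> x y t Kx Ky t0 t1 /=.
  have -> : t *: x + (1 - t) *: y + base c =
      t *: (x + base c) + (1 - t) *: (y + base c).
    by rewrite !scalerDr addrACA -[in RHS]scalerDl subrKC scale1r.
  exact: conv_hull_convex.
move=> x [Px /not_interiorP[f ffs fx]] /=.
have Kout y g : P y -> g \in fs -> 0 <= dot (intv g) (hom_pt y 1) -> R_op L P y.
  move=> Py gfs gy; apply: sub_gen_smallest; split=> //.
  by apply/not_interiorP; exists g.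
have dotD g sg : dot (intv g) (hom_pt (x + sg *: base c) 1) =
    dot (intv g) (hom_pt x 1) + sg * dot (intv g) c.
  rewrite -[in RHS](homK c) c0 -dotZr -dotDr -hom_ptZ -hom_ptD.
  by rewrite mulr0 addr0.
have [fc|fc] := leP 0 (dot (intv f) c).
  apply: (Kout _ f) => //; first exact: slice_cone_add.
  by have := dotD f 1; rewrite scale1r mul1r => ->; exact: addr_ge0.
have [g gfs gc] : exists2 g, g \in fs & 0 < dot (intv g) c.
  apply: contrapT => noc; have [_ _ /(_ c c0) cP] := LP.
  suff : dot (intv f) c = 0 by move=> fc0; rewrite fc0 ltxx in fc.
  apply: cP => // g gfs; rewrite leNgt; apply/negP => gc; apply: noc.
  by exists g.
(* far enough for the form g to be nonnegative, and beyond x + base c *)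
pose sg := 1 + `|dot (intv g) (hom_pt x 1)| / dot (intv g) c.
have sg1 : 1 <= sg by rewrite lerDl divr_ge0 // ltW.
have sg0 : 0 < sg by exact: lt_le_trans sg1.
have -> : x + base c = sg^-1 *: (x + sg *: base c) + (1 - sg^-1) *: x.
  rewrite scalerDr scalerA mulVf ?gt_eqF // scale1r addrAC -scalerDl subrKC.
  by rewrite scale1r.
apply: conv_hull_convex; rewrite ?invr_ge0 ?invf_le1 ?(ltW sg0) //.
  apply: (Kout _ g) => //.
    rewrite -linearZ; apply: slice_cone_add => //; last by rewrite heightZ c0 mulr0.
    by apply: cone_hullZ => //; exact: ltW.
  rewrite dotD mulrDl mul1r divfK ?gt_eqF //.
  by have := ler_norm (- dot (intv g) (hom_pt x 1)); rewrite normrN; lra.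
exact: (Kout _ f).
Qed.

Hypothesis Gam_height : forall g, g \in Gam -> 0 <= height g.

Lemma height_int_cone (y : 'rV[R]_(d + 1)) : int_cone Gam y -> 0 <= height y.
Proof.
move: y; apply: (@int_cone_min _ _ Gam [set y | 0 <= height y]) => [|g gG].
  split=> /=[|x y x0 y0|t x t0 x0]; first by rewrite /height mxE.
  - by rewrite heightD addr_ge0.
  - by rewrite heightZ mulr_ge0.
by rewrite /= height_intv ler0z Gam_height.
Qed.

(** The homogenization of R_L(P): the points of positive height over it,
together with the recession directions of P. *)
Let lifted : set 'rV[R]_(d + 1) :=
  [set y | int_cone Gam y /\
     (0 < height y -> R_op L P ((height y)^-1 *: base y))].

Let lifted_cone : convex_cone lifted.
Proof.
have merge y y' : lifted y -> lifted y' -> 0 < height y -> height y' = 0 ->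
    R_op L P ((height (y + y'))^-1 *: base (y + y')).
  move=> [Gy Ky] [Gy' _] y0 y'0; rewrite heightD y'0 addr0 [base _]linearD scalerDr.
  rewrite -[X in _ + X]linearZ; apply: R_op_recession => //.
  - by apply: cone_hullZ => //; rewrite invr_ge0 ltW.
  - by rewrite heightZ y'0 mulr0.
  - exact: Ky.
split=> [|y y' Ky Ky'|t y t0 [Gy Ky]].
- by split; [exact: cone_hull0|rewrite /height mxE ltxx].
- have [Gy Py] := Ky; have [Gy' Py'] := Ky'; split; first exact: cone_hullD.
  have := height_int_cone _ Gy'; rewrite le_eqVlt => /orP[/eqP/esym y'0|y'0].
    rewrite heightD y'0 addr0 => y0.
    by rewrite -[height y]addr0 -y'0 -heightD; exact: merge.
  have := height_int_cone _ Gy; rewrite le_eqVlt => /orP[/eqP/esym y0|y0] _.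
    by rewrite addrC; apply: merge.
  rewrite heightD [base _]linearD.
  have yy0 : 0 < height y + height y' by rewrite addr_gt0.
  have -> : (height y + height y')^-1 *: (base y + base y') =
      (height y / (height y + height y')) *: ((height y)^-1 *: base y) +
      (1 - height y / (height y + height y')) *: ((height y')^-1 *: base y').
    rewrite scalerDr !scalerA; congr (_ *: _ + _ *: _); field;
      by rewrite ?(gt_eqF y0) ?(gt_eqF y'0) ?(gt_eqF yy0).
  apply: conv_hull_convex; [exact: Py|exact: Py'| |].
    by rewrite divr_ge0 ?ltW.
  by rewrite ler_pdivrMr // mul1r lerDl ltW.
- split; first exact: cone_hullZ.
  move: t0; rewrite heightZ le_eqVlt => /orP[/eqP<-|t0].
    by rewrite mul0r ltxx.
  rewrite pmulr_rgt0 // => y0; rewrite [base _]linearZ scalerA /=.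
  by rewrite invfM mulrAC mulVf ?gt_eqF // mul1r; exact: Ky.
Qed.

Variables (M : nat) (s : 'rV[int]_(d + 1) -> 'rV[int]_(d + 1) -> nat).
Hypothesis M_gt0 : (0 < M)%N.
Hypothesis sP : forall g h, g \in Gam -> h \in Gam -> height g != 0 ->
  inside fs g -> crossing M fs g h (s g h).

Let lifted_out (y : 'rV[R]_(d + 1)) f : int_cone Gam y -> f \in fs ->
  0 <= dot (intv f) y -> lifted y.
Proof.
move=> Gy ffs fy; split=> // y0; apply: sub_gen_smallest.
have yE : hom_pt ((height y)^-1 *: base y) 1 = (height y)^-1 *: y.
  by rewrite -[1](@mulVf _ (height y)) ?gt_eqF // hom_ptZ homK.
have y0' : 0 <= (height y)^-1 by rewrite invr_ge0 ltW.
split; first by rewrite /P /slice /= yE; exact: cone_hullZ.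
apply/not_interiorP; exists f => //; rewrite yE linearZ.
exact: mulr_ge0.
Qed.

(** A point of P outside the interior of L lies in the halfspace f >= 0 of some
form f, so that [cone_halfspace_sub] applies with f: if f separates g inside
from h outside, the segment between h and the crossing vector contains the
point where f vanishes, because f is one of the forms defining sigma. *)
Theorem R_op_slice : R_op L P = slice (int_cone (cut_gens Gam M fs s)).
Proof.
apply/seteqP; split.
  apply: conv_hull_min => [x y t|x [Px /not_interiorP[f ffs]]].
    by apply: slice_cone_convex; exact: cone_hull_cone.
  set K := int_cone (cut_gens Gam M fs s).
  have keep g : g \in Gam -> 0 <= dot f g -> K (intv g).
    move=> gG fg; apply: cut_gens_keep => //; apply/orP; right.
    by apply/allPn; exists f; rewrite // -leNgt.
  apply: (@cone_halfspace_sub _ _ [set intv g | g in [set` Gam]] K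
    (dot (intv f) : {linear _ -> R^o}));
    [exact: cone_hull_cone| | |exact: Px].
    by move=> _ [g gG <-]; rewrite /= dot_intv ler0z; exact: keep.
  move=> _ _ [g gG <-] [h hG <-] /=; rewrite !dot_intv ltr0z ltrz0 => fg fh.
  have hK : K (intv h) by apply: keep => //; exact: ltW.
  have fg0 : 0 <= - (dot f g)%:~R :> R by rewrite oppr_ge0 lerz0 ltW.
  have fh0 : 0 <= (dot f h)%:~R :> R by rewrite ler0z ltW.
  have [gk|] := boolP ((height g == 0) || ~~ inside fs g).
    rewrite -scaleNr; apply: cone_hullD; apply: cone_hullZ => //.
    exact: cut_gens_keep.
  rewrite negb_or negbK => /andP[g0 gin].
  have [/(_ f ffs) sf _] := sP g h gG hG g0 gin.
  have sgh : (0 < s g h)%N.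
    rewrite lt0n; apply: contraTneq sf => ->.
    by rewrite mul0r addr0 -ltNge mulr_gt0 // ltz_nat.
  have := cut_gens_cross (R := R) Gam M fs s g h gG hG g0 gin sgh.
  set e := _ + _ => econe.
  have s0 : (0 : R) < (s g h)%:R by rewrite ltr0n.
  apply: (cone_divZ _ _ (cone_hull_cone _) s0).
  have -> : (s g h)%:R *: ((dot f h)%:~R *: intv g - (dot f g)%:~R *: intv h) =
      (dot f h)%:~R *: e +
      (- (M%:Z * dot f h + (s g h)%:Z * dot f g))%:~R *: intv h :> 'rV[R]_(d + 1).
    rewrite /e scalerBr [in RHS]scalerDr !scalerA [RHS]addrAC -scalerDl [RHS]addrC.
    congr (_ + _).
      by rewrite mulrC.
    rewrite -scaleNr; congr (_ *: _).
    by rewrite rmorphN rmorphD !rmorphM /=; ring.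
  apply: cone_hullD; apply: cone_hullZ => //.
  by rewrite ler0z oppr_ge0.
have lifted_gens : int_cone (cut_gens Gam M fs s) `<=` lifted.
  apply: cut_gens_min => // [g gG|g h gG hG g0 gin sgh].
    move=> /orP[/eqP g0|/allPn[f ffs]].
      split; first exact: mem_int_cone.
      by rewrite height_intv g0 ltxx.
    rewrite -leNgt => fg; apply: (lifted_out _ f) => //; first exact: mem_int_cone.
    by rewrite dot_intv ler0z.
  have [_ /(_ sgh)[f ffs fe]] := sP g h gG hG g0 gin.
  apply: (lifted_out _ f) => //.
    by apply: cone_hullD; apply: cone_hullZ; rewrite ?ler0n//; exact: mem_int_cone.
  rewrite linearD !linearZ /= !dot_intv.
  by move/(congr1 (intr : int -> R)): fe; rewrite rmorphD !rmorphM /= => ->.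
move=> x /lifted_gens[_]; rewrite height_hom base_hom invr1 scale1r.
by apply; rewrite ltr01.
Qed.

End Representation.

(** * Facets of full-dimensional polyhedra *)
Lemma primitive_multiple {n} (w : 'rV[int]_n) : w != 0 ->
  exists (c : int) (z : 'rV[int]_n),
    [/\ 0 < c, z != 0, \big[gcdz/0]_(i < n) z 0 i = 1 & w = c *: z].
Proof.
move=> w0; pose c := \big[gcdz/0]_(i < n) w 0 i.
have c_dvd i : (c %| w 0%R i)%Z.
  rewrite /c; elim: (index_enum _) (mem_index_enum i) => // j s IHs.
  rewrite in_cons big_cons => /orP[/eqP <-|/IHs]; first exact: dvdz_gcdl.
  by apply: dvdz_trans; exact: dvdz_gcdr.
have c_ge0 : 0 <= c.
  by rewrite /c; elim: (index_enum _) => [|j s _]; rewrite ?big_nil ?big_cons.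
have c0 : c != 0.
  apply: contra w0 => /eqP c0; apply/eqP/rowP => i; rewrite mxE; apply/eqP.
  by rewrite -dvd0z -c0.
have wE : w = c *: \row_i (w 0%R i %/ c)%Z.
  by apply/rowP => i; rewrite !mxE mulrC divzK.
exists c, (\row_i (w 0%R i %/ c)%Z); split=> //.
- by rewrite lt_neqAle eq_sym c0.
- by apply: contra w0 => /eqP z0; rewrite wE z0 scaler0.
- apply: (mulfI c0); rewrite mulr1 -[in RHS]/(\big[gcdz/0]_(i < n) w 0 i).
  have gcdM (x y : int) : c * gcdz x y = gcdz (c * x) (c * y).
    by rewrite -mulz_gcdr gez0_abs.
  rewrite (big_morph _ gcdM (mulr0 c)); apply: eq_bigr => i _.
  by rewrite [in RHS]wE !mxE.
Qed.

Section Facets.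
Context {R : realType} {d : nat}.
Implicit Types (L : set 'rV[R]_d).

Definition int_halfspaces n (z : 'I_n -> 'rV[int]_d) (beta : 'I_n -> R) :=
  [set x : 'rV[R]_d | forall i, dot (intv (z i)) x <= beta i].

Definition primitive (z : 'rV[int]_d) := z != 0 /\ \big[gcdz/0]_(i < d) z 0 i = 1.

Lemma rational_polyhedron_primitive L : rational_polyhedron L -> L !=set0 ->
  exists n (z : 'I_n -> 'rV[int]_d) beta,
    (forall i, primitive (z i)) /\ L = int_halfspaces n z beta.
Proof.
move=> /rational_polyhedron_slice[A LA] [x0 Lx0].
pose B := [seq a <- A | base a != 0].
have /choice[zc zcP] (i : 'I_(size B)) : exists zc : 'rV[int]_d * int,
    [/\ 0 < zc.2, primitive zc.1 & base (nth 0 B i) = zc.2 *: zc.1].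
  have := mem_nth 0 (ltn_ord i); rewrite mem_filter => /andP[b0 _].
  by have [c [z [c0 z0 z1 bE]]] := primitive_multiple _ b0; exists (z, c).
exists (size B), (fun i : 'I_(size B) => (zc i).1),
  (fun i : 'I_(size B) => - (height (nth 0 B i))%:~R / (zc i).2%:~R).
split=> [i|]; first by have [] := zcP i.
have rowE (x : 'rV[R]_d) (i : 'I_(size B)) : (dot (intv (nth 0 B i)) (hom_pt x 1) <= 0) =
    (dot (intv (zc i).1) x <= - (height (nth 0 B i))%:~R / (zc i).2%:~R).
  have [c0 _ bE] := zcP i.
  rewrite dotE base_intv base_hom height_intv height_hom mulr1 bE.
  by rewrite map_mxZ dotZl ler_pdivlMr ?ltr0z // -lerBrDr sub0r mulrC.
rewrite LA; apply/seteqP; split=> [x xA i|x xB a aA].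
  rewrite -rowE; apply: xA.
  by have := mem_nth 0 (ltn_ord i); rewrite mem_filter => /andP[].
have [a0|a0] := eqVneq (base a) 0.
  move: Lx0; rewrite LA => /(_ a aA); rewrite 2!dotE !base_intv a0.
  by rewrite map_mx0 !(dotC 0) !linear0 !height_hom.
have aB : a \in B by rewrite mem_filter a0.
rewrite -(nth_index 0 aB); rewrite -index_mem in aB.
by rewrite (rowE x (Ordinal aB)); exact: xB.
Qed.

Lemma drop_halfspace n z beta i : int_halfspaces n.+1 z beta =
  int_halfspaces n (z \o lift i) (beta \o lift i) `&`
  [set x | dot (intv (z i)) x <= beta i].
Proof.
apply/seteqP; split=> [x xz|x [xz xi] j].
  by split=> [j|]; exact: xz.
by case: (unliftP i j) => [k ->|->] //; exact: xz.
Qed.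

(** In a description with the least number of inequalities, dropping one of
them enlarges the set, which provides a point violating only this one. *)
Lemma irredundant_description L : rational_polyhedron L -> L !=set0 ->
  exists n (z : 'I_n -> 'rV[int]_d) beta,
    [/\ forall i, primitive (z i), L = int_halfspaces n z beta &
        forall i, exists2 y, beta i < dot (intv (z i)) y &
          forall j, j != i -> dot (intv (z j)) y <= beta j].
Proof.
move=> Lrat L0.
pose describable n := exists (z : 'I_n -> 'rV[int]_d) beta,
  (forall i, primitive (z i)) /\ L = int_halfspaces n z beta.
have ex_n : exists n, `[< describable n >].
  have [n [z [beta zP]]] := rational_polyhedron_primitive L Lrat L0.
  by exists n; apply/asboolP; exists z, beta.
case: (ex_minnP ex_n) => n /asboolP[z [beta [zP LE]]] nmin.
exists n, z, beta; split=> // i; apply: contrapT => noy.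
case: n i z beta zP LE nmin noy => [[]//|n i z beta zP LE nmin noy].
have : describable n.
  exists (z \o lift i), (beta \o lift i); split=> [j|]; first exact: zP.
  rewrite LE (drop_halfspace _ z beta i); apply/seteqP; split=> [x []//|x xz].
  split=> //=; rewrite leNgt; apply/negP => xi; apply: noy; exists x => // j ji.
  by case: (unliftP i j) ji => [k ->|->]; [move=> _; exact: xz|rewrite eqxx].
by move/asboolP/nmin; rewrite ltnn.
Qed.

Lemma full_dim_aff_hull L : has_dim L d -> aff_hull L = setT.
Proof.
move=> [x [V [-> dV]]].
have -> : V = fullv.
  by apply/eqP; rewrite eqEdim subvf dV dimvf /dim /= mul1n leqnn.
apply/seteqP; split=> // y _; exists (y - x); first by rewrite /= memvf.
by rewrite subrKC.
Qed.

Lemma full_dim_nonempty L : has_dim L d -> L !=set0.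
Proof.
move=> /full_dim_aff_hull LT; apply/set0P/eqP => L0.
have : aff_hull L 0 by rewrite LT.
by apply: (@smallest_sub _ _ L set0); rewrite ?L0.
Qed.

Lemma dot_intv_gt0 (z : 'rV[int]_d) : z != 0 -> 0 < dot (intv z) (intv z) :> R.
Proof.
move=> z0; rewrite dot_intv ltr0z lt_neqAle eq_sym; apply/andP; split; last first.
  by apply: sumr_ge0 => i _; rewrite -expr2 sqr_ge0.
apply: contra z0; rewrite psumr_eq0 => [/allP zz|i _]; last by rewrite -expr2 sqr_ge0.
apply/eqP/rowP => i; have := zz i (mem_index_enum _).
by rewrite -expr2 sqrf_eq0 mxE => /eqP.
Qed.

(** If some inequality were an equation on the whole set, its hyperplane would
contain the affine hull. The midpoint of points strict for different
inequalities is strict for both. *)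
Lemma full_dim_strict_point n z beta : (forall i, z i != 0) ->
  has_dim (int_halfspaces n z beta) d ->
  exists x, forall i, dot (intv (z i)) x < beta i.
Proof.
move=> z0 Ldim; set L := int_halfspaces _ _ _ in Ldim.
have strict i : exists2 x, L x & dot (intv (z i)) x < beta i.
  apply: contrapT => nox.
  have Lflat : L `<=` [set x | dot (intv (z i)) x = beta i].
    move=> x Lx; apply: le_anti; rewrite (Lx i) /= leNgt; apply/negP => xi.
    by apply: nox; exists x.
  have affT : aff_hull L `<=` [set x | dot (intv (z i)) x = beta i].
    apply: smallest_sub => // x y t /= xi yi.
    by rewrite linearD !linearZ /= xi yi -mulrDl subrKC mul1r.
  have all_eq (x : 'rV[R]_d) : dot (intv (z i)) x = beta i.
    by apply: affT; rewrite (full_dim_aff_hull _ Ldim).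
  have := dot_intv_gt0 _ (z0 i); rewrite all_eq -(all_eq 0) linear0.
  by rewrite ltxx.
suff : exists2 x, L x & forall i, i \in enum 'I_n -> dot (intv (z i)) x < beta i.
  by move=> [x _ xi]; exists x => i; apply: xi; rewrite mem_enum.
elim: (enum _) => [|i s [x Lx xs]].
  by have [x Lx] := full_dim_nonempty _ Ldim; exists x.
have [y Ly yi] := strict i; exists (2^-1 *: (x + y)) => [j|j].
  by rewrite linearZ linearD /=; have := Lx j; have := Ly j; lra.
rewrite in_cons linearZ linearD /= => /orP[/eqP ->|/xs].
  by have := Lx i; lra.
by have := Ly j; lra.
Qed.

Lemma hyperplane_dim (z : 'rV[int]_d) (p : 'rV[R]_d) : z != 0 ->
  exists V : {vspace 'rV[R]_d},
    [set x | dot (intv z) x = dot (intv z) p] = [set p + v | v in [set` V]] /\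
    \dim V = d.-1.
Proof.
move=> z0; pose f : {linear 'rV[R]_d -> R^o} := dot (intv z).
exists (lker (linfun f)); split.
  apply/seteqP; split=> [x /= xp|_ [v vK <-] /=].
    exists (x - p); last by rewrite subrKC.
    by rewrite /= memv_ker lfunE /= linearB /= xp subrr.
  move: vK; rewrite /= memv_ker lfunE /= => /eqP vK.
  by rewrite linearD /= vK addr0.
have := limg_ker_dim (linfun f) fullv; rewrite capfv [in RHS]dimvf [in RHS]/dim /= mul1n.
suff -> : \dim (limg (linfun f)) = 1%N by rewrite addn1 => /(congr1 predn).
apply/eqP; rewrite eqn_leq; apply/andP; split.
  by apply: leq_trans (dimvS (subvf _)) _; rewrite dimvf.
rewrite lt0n dimv_eq0; apply/eqP => lim0.
have : linfun f (intv z) \in limg (linfun f) by rewrite memv_img ?memvf.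
by rewrite lim0 memv0 lfunE /= gt_eqF ?dot_intv_gt0.
Qed.

Lemma uniform_step n (u v : 'I_n -> R) : (forall i, 0 < v i) ->
  exists2 e : R, 0 < e & forall i, e * u i <= v i.
Proof.
move=> v0; pose S := 1 + \sum_i `|u i| / v i.
have S1 : 1 <= S by rewrite lerDl sumr_ge0 // => i _; rewrite divr_ge0 // ltW.
exists S^-1 => [|i]; first by rewrite invr_gt0 (lt_le_trans _ S1).
rewrite mulrC ler_pdivrMr ?(lt_le_trans _ S1) //.
apply: le_trans (ler_norm _) _; rewrite mulrC -ler_pdivrMr //.
rewrite /S (bigD1 i) //= addrCA lerDl addr_ge0 // sumr_ge0 // => j _.
by rewrite divr_ge0 // ltW.
Qed.

(** The segment from a strict point to a point violating only inequality i
crosses the hyperplane i at a point p strict for all other inequalities, so a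
neighbourhood of p in the hyperplane belongs to the face. *)
Lemma irredundant_facet n z beta i : (forall j, z j != 0) ->
    (exists x, forall j, dot (intv (z j)) x < beta j) ->
    (exists2 y, beta i < dot (intv (z i)) y &
       forall j, j != i -> dot (intv (z j)) y <= beta j) ->
  let L := int_halfspaces n z beta in
  let F := face_in L (intv (z i)) in
  [/\ is_facet L F, F !=set0, F `<=` [set x | dot (intv (z i)) x = beta i] &
      aff_hull F `<=` [set x | dot (intv (z i)) x = beta i]].
Proof.
move=> z0 [x0 x0P] [y yi yP] L F.
have xi := x0P i.
have yx : 0 < dot (intv (z i)) y - dot (intv (z i)) x0 by lra.
pose th := (beta i - dot (intv (z i)) x0) / (dot (intv (z i)) y - dot (intv (z i)) x0).
have th0 : 0 < th by rewrite divr_gt0 // subr_gt0.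
have th1 : th < 1 by rewrite ltr_pdivrMr // mul1r; lra.
pose p := x0 + th *: (y - x0).
have pE j : dot (intv (z j)) p =
    dot (intv (z j)) x0 + th * (dot (intv (z j)) y - dot (intv (z j)) x0).
  by rewrite linearD linearZ /= linearB.
have pi : dot (intv (z i)) p = beta i by rewrite pE divfK ?gt_eqF // subrKC.
have pj j : j != i -> dot (intv (z j)) p < beta j.
  by move=> ji; rewrite pE; have := yP j ji; have := x0P j; nra.
have Lp : L p.
  move=> j; have [->|ji] := eqVneq j i; first by rewrite pi.
  exact: ltW (pj j ji).
(* as p attains beta i, the maximum of the form on L is beta i *)
have FP x : F x <-> L x /\ dot (intv (z i)) x = beta i.
  split=> [[Lx xmax]|[Lx xi']]; split=> //.
    by apply: le_anti; rewrite (Lx i) /= -pi; exact: xmax.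
  by move=> w Lw; rewrite !dotrE xi'; exact: Lw.
have Fp : F p by apply/FP.
have Fsub : F `<=` [set x | dot (intv (z i)) x = beta i] by move=> x /FP[].
have Fhull : aff_hull F = [set x | dot (intv (z i)) x = beta i].
  apply/seteqP; split.
    apply: smallest_sub => // x w t /= xi' wi.
    by rewrite linearD !linearZ /= xi' wi -mulrDl subrKC mul1r.
  move=> x /= xi' A [Aaff FA].
  have slack0 j : 0 < if j == i then 1 else beta j - dot (intv (z j)) p.
    by case: eqVneq => // ji; rewrite subr_gt0 pj.
  have [e e0 eP] := uniform_step n
    (fun j => if j == i then 0 else dot (intv (z j)) (x - p)) _ slack0.
  have Fq : F (p + e *: (x - p)).
    apply/FP; split=> [j|]; last first.
      by rewrite linearD linearZ /= linearB /= xi' pi subrr mulr0 addr0.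
    rewrite linearD linearZ /=; have := eP j.
    case: eqVneq => [->|ji]; last by rewrite lerBrDl.
    by rewrite linearB /= xi' pi subrr mulr0 addr0.
  have -> : x = e^-1 *: (p + e *: (x - p)) + (1 - e^-1) *: p.
    rewrite scalerDr scalerA mulVf ?gt_eqF // scale1r addrAC -scalerDl subrKC.
    by rewrite scale1r subrKC.
  by apply: Aaff; exact: FA.
split=> //; [split|by exists p|by rewrite Fhull].
  exists (intv (z i)); split=> //; apply/eqP => zi0.
  have : 0 < dot (intv (z i)) (intv (z i)) :> R := dot_intv_gt0 _ (z0 i).
  by rewrite zi0 linear0 ltxx.
have [V [VE dV]] := hyperplane_dim (z i) p (z0 i).
by exists p, V; split=> //; rewrite Fhull -VE pi.
Qed.

Lemma dot_continuous (u : 'rV[R]_d) : continuous (dot u : 'rV[R]_d -> R).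
Proof.
rewrite /dot; apply: continuous_big; first exact: add_continuous.
move=> i _ x; apply: (@continuousM _ _ (fun=> u 0 i) (fun v : 'rV[R]_d => v 0 i)).
  exact: (@cst_continuous _ _ (u 0 i)).
exact: coord_continuous.
Qed.

Lemma interior_int_halfspaces n z beta : (forall i, z i != 0) ->
  interior (int_halfspaces n z beta) =
  [set x | forall i, dot (intv (z i)) x < beta i].
Proof.
move=> z0; apply/seteqP; split=> x.
  move=> xint i.
  have cvgx : x + t *: intv (z i) @[t --> (0 : R)] --> x.
    rewrite -[X in _ --> X]addr0 -(scale0r (intv (z i))).
    apply: cvgD; first exact: cvg_cst.
    exact: scalel_continuous.
  have /nbhs_ballP[e /= e0 eP] := cvgx _ xint.
  have e20 : 0 < e / 2 by rewrite divr_gt0.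
  have /eP/(_ i) /= : ball (0 : R) e (e / 2).
    by rewrite /ball /= sub0r normrN gtr0_norm // ltr_pdivrMr // ltr_pMr // ltr1n.
  rewrite linearD linearZ /=; apply: lt_le_trans; rewrite ltrDl mulr_gt0 //.
  exact: dot_intv_gt0.
move=> xlt; have : \forall y \near x, forall i, dot (intv (z i)) y < beta i.
  apply: (@filter_forall _ _ (fun i y => dot (intv (z i)) y < beta i) (nbhs x)) => i.
  apply: (cvgr_lt (dot (intv (z i)) x)) (xlt i).
  exact: dot_continuous.
by apply: filterS => y ylt i; exact: ltW.
Qed.

End Facets.

(** * Facet forms with integer coefficients *)
Lemma facet_width_le {R : realType} {d} (L : set 'rV[R]_d) z (c : R) x p :
  facet_normals L z -> (maxfw L <= c%:E)%E -> L x -> L p ->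
  dot (intv z) p - dot (intv z) x <= c.
Proof.
move=> zL Lc Lx Lp; rewrite -lee_fin; apply: le_trans Lc.
have : (width L (intv z) <= maxfw L)%E by apply: ereal_sup_ubound; exists z.
apply: le_trans; rewrite EFinB; apply: leeB.
  by apply: ereal_sup_ubound; exists p.
by apply: ereal_inf_lbound; exists x.
Qed.

(** The facet description supplies the forms. The bound on values and the
statement on recession directions both come from the inequality
beta_i - k <= <z_i, x> on L, which is the width bound at a point of the facet;
the integrality of l beta_i is the hypothesis on facets at a lattice point of the dilated
affine hull of the facet. *)
Lemma lattice_description {R : realType} {d} (L : set 'rV[R]_d) (k l : nat) :
    (0 < l)%N -> rational_polyhedron L -> has_dim L d ->
    (maxfw L <= k%:R%:E)%E ->
    (forall F, is_facet L F ->
       [set l%:R *: x | x in aff_hull F] `&` @Zlattice R d !=set0) ->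
  exists fs, bounded_description (l * k)%N%:Z fs L.
Proof.
move=> l0 Lrat Ldim Lk Ll; have L0 := full_dim_nonempty _ Ldim.
have [n [z [beta [zP LE irred]]]] := irredundant_description L Lrat L0.
have z0 i : z i != 0 by have [] := zP i.
have l0R : 0 < l%:R :> R by rewrite ltr0n.
have [x0 x0P] : exists x, forall i, dot (intv (z i)) x < beta i.
  by apply: full_dim_strict_point => //; rewrite -LE.
have facet i := irredundant_facet n z beta i z0 (ex_intro _ x0 x0P) (irred i).
have lo i x : L x -> beta i - k%:R <= dot (intv (z i)) x.
  move=> Lx; have [Ffacet [p Fp] Fsub _] := facet i.
  have zL : facet_normals L (z i).
    have [_ z1] := zP i; split=> //; rewrite LE.
    exists (face_in (int_halfspaces n z beta) (intv (z i))); split=> //.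
    split=> //; apply/eqP => zi0; have := dot_intv_gt0 (R := R) _ (z0 i).
    by rewrite zi0 linear0 ltxx.
  have Lp : L p by rewrite LE; case: Fp.
  have := facet_width_le _ _ _ _ _ zL Lk Lx Lp; rewrite (Fsub _ Fp).
  by rewrite lerBlDr lerBlDl.
have /choice[b bP] i : exists b : int, l%:R * beta i = b%:~R.
  have [Ffacet _ _ Fhull] := facet i; rewrite -LE in Ffacet Fhull.
  have [_ [[x Fx <-] [w _ wx]]] := Ll _ Ffacet.
  exists (dot (z i) w); rewrite -(Fhull _ Fx) -dotZr -wx.
  by rewrite dot_intv.
pose f i : 'rV[int]_(d + 1) := hom_pt (l%:Z *: z i) (- b i).
have fE i (x : 'rV[R]_d) c : dot (intv (f i)) (hom_pt x c) =
    l%:R * (dot (intv (z i)) x - beta i * c).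
  rewrite /f hom_intv dot_hom map_mxZ dotZl rmorphN /= -bP mulrBr mulrA.
  by rewrite mulNr.
exists [seq f i | i : 'I_n]; split.
- rewrite LE interior_int_halfspaces //; apply/seteqP; split=> x xP.
    move=> _ /mapP[i _ ->]; rewrite fE mulr1 pmulr_rlt0 // subr_lt0; exact: xP.
  move=> i; have /xP : f i \in [seq f i | i : 'I_n] by rewrite map_f ?mem_enum.
  by rewrite fE mulr1 pmulr_rlt0 // subr_lt0.
- move=> _ g /mapP[i _ ->] g0 /allP gin.
  have g0R : 0 < (height g)%:~R :> R by rewrite ltr0z.
  have gE : intv g = hom_pt (intv (base g)) (height g)%:~R :> 'rV[R]__.
    by rewrite -hom_intv homK.
  have Lg : L ((height g)%:~R^-1 *: intv (base g)).
    rewrite LE => j; rewrite linearZ /= mulrC ler_pdivrMr //.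
    have : dot (f j) g < 0 by apply: gin; rewrite map_f ?mem_enum.
    rewrite -(ltrz0 R) -dot_intv gE fE pmulr_rlt0 // subr_lt0.
    exact: ltW.
  have := lo i _ Lg; rewrite linearZ /= mulrC ler_pdivlMr // mulrBl => loi.
  rewrite -(ler_int R) rmorphN /= -dot_intv gE fE -mulrN opprB rmorphM /= -pmulrn.
  rewrite natrM -mulrA ler_pM2l //; lra.
- move=> c c0 cle _ /mapP[i _ ->]; rewrite -(homK c) c0 fE mulr0 subr0.
  apply/eqP; rewrite mulf_eq0 gt_eqF //=.
  have cneg j : dot (intv (z j)) (base c) <= 0.
    have /cle : f j \in [seq f i | i : 'I_n] by rewrite map_f ?mem_enum.
    by rewrite -(homK c) c0 fE mulr0 subr0 pmulr_rle0 // base_hom.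
  rewrite eq_le cneg /= leNgt; apply/negP => ci.
  (* moving t steps decreases the form z i by k + 1 *)
  pose t := (k%:R + 1) / - dot (intv (z i)) (base c).
  have t0 : 0 <= t by rewrite divr_ge0 ?oppr_ge0 // ltW.
  have Lt : L (x0 + t *: base c).
    rewrite LE => j; rewrite linearD linearZ /=.
    by have := x0P j; have := cneg j; nra.
  have := lo i _ Lt; rewrite linearD linearZ /= /t invrN mulrN mulNr divfK ?lt_eqF //.
  by have := x0P i; lra.
Qed.

(** * Dickson's lemma and the finite generation of closures *)

(** Induction on the number of coordinates. A finite family F0 that dominates
for the coordinates js also does so for the new coordinate j on the elements
where this is at least the maximum B on F0; the remaining elements are treated
separately for each of the B values of j. *)
Lemma dickson {X : Type} {J : eqType} (js : seq J) (f : J -> X -> nat) (S : set X) :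
  exists F, [/\ F `<=` S, finite_set F &
    forall x, S x -> exists2 y, F y & forall j, j \in js -> (f j y <= f j x)%N].
Proof.
elim: js S => [|j js IHjs] S.
  have [[x Sx]|noS] := pselect (S !=set0).
    exists [set x]; split=> [_ ->|//|y _] //.
    by exists x.
  exists set0; split=> // x Sx; case: noS; by exists x.
have [F0 [F0S /finite_setP F0fin F0P]] := IHjs S.
have F0fin' : finite_set F0 by apply/finite_setP.
have [B BP] : exists B, forall y, F0 y -> (f j y <= B)%N.
  have /finite_seqP[ns nsE] : finite_set (f j @` F0) by exact: finite_image.
  exists (\max_(m <- ns) m)%N => y F0y.
  have : f j y \in ns by have : (f j @` F0) (f j y) by [exists y]; rewrite nsE.
  by move=> yns; apply: (@leq_bigmax_seq _ ns xpredT id).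
have /choice[Fb FbP] b := IHjs (S `&` [set x | f j x = b]).
exists (F0 `|` \bigcup_(b in `I_B) Fb b); split.
- move=> x [/F0S //|[b _ Fbx]]; have [/(_ _ Fbx)[]//] := FbP b.
- rewrite finite_setU; split=> //; apply: bigcup_finite; first exact: finite_II.
  by move=> b _; have [] := FbP b.
- move=> x Sx; have [Bx|xB] := leqP B (f j x).
    have [y F0y yP] := F0P x Sx; exists y; first by left.
    move=> i; rewrite in_cons => /orP[/eqP ->|]; last exact: yP.
    exact: leq_trans (BP y F0y) Bx.
  have [FS _ /(_ x)[//|y Fy yP]] := FbP (f j x).
  exists y; first by right; exists (f j x).
  move=> i; rewrite in_cons => /orP[/eqP ->|]; last exact: yP.
  by have [_ ->] := FS _ Fy.
Qed.

(** Adding the inequality height >= 0 does not change the slice and excludes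
generators of negative height. *)
Lemma slice_int_cone_generators {R : realType} {d} (P : set 'rV[R]_d) :
  rational_polyhedron P -> exists Gam : seq 'rV[int]_(d + 1),
    (forall g, g \in Gam -> 0 <= height g) /\ P = slice (int_cone Gam).
Proof.
move=> /rational_polyhedron_slice[A PA].
pose A' := hom_pt 0 (- 1 : int) :: A.
have [Gam GamE] := int_polar_generated (R := R) A'.
have h0E (y : 'rV[R]_(d + 1)) : dot (intv (hom_pt 0 (- 1 : int))) y = - height y.
  rewrite dotE hom_intv base_hom height_hom map_mx0 dotC linear0 add0r.
  by rewrite rmorphN1 mulN1r.
exists Gam; split=> [g gG|].
  have : int_polar A' (intv g : 'rV[R]__) by rewrite GamE; exact: mem_int_cone.
  move=> /(_ _ (mem_head _ _)); rewrite h0E oppr_le0.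
  by rewrite height_intv ler0z.
rewrite PA -GamE; apply/seteqP; split=> x xA a; last first.
  by move=> aA; apply: xA; rewrite in_cons aA orbT.
rewrite in_cons => /orP[/eqP->|]; last exact: xA.
by rewrite h0E height_hom oppr_le0.
Qed.

Lemma dvdz_fact_le (a : int) (n : nat) : 0 < a -> a <= n%:Z -> (a %| (n`!)%:Z)%Z.
Proof.
move=> a0 an; have -> : a = `|a|%N by rewrite gez0_abs // ltW.
by rewrite dvdzE !absz_nat dvdn_fact //; apply/andP; split; lia.
Qed.

Theorem theorem3p3 (R : realType) (d : nat) (d_gt0 : (0 < d)%N)
  (P : set 'rV[R]_d) (P_ratpoly : rational_polyhedron P)
  (calL : set (set 'rV[R]_d)) (calL_neq0 : calL !=set0)
  (calL_ratpoly : forall L, calL L -> rational_polyhedron L /\ has_dim L d)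
  (cond_a : exists k : nat, (0 < k)%N /\
     forall L, calL L -> (maxfw L <= k%:R%:E)%E)
  (cond_b : exists l : nat, (0 < l)%N /\
     forall L F, calL L -> is_facet L F ->
       [set l%:R *: x | x in aff_hull F] `&` @Zlattice R d !=set0) :
  [/\ (exists calL' : set (set 'rV[R]_d),
         [/\ calL' `<=` calL, finite_set calL' &
             forall L, calL L ->
               exists2 L', calL' L' & R_op L' P `<=` R_op L P]),
      (exists calL' : set (set 'rV[R]_d),
         [/\ calL' `<=` calL, finite_set calL', calL' !=set0 &
             R_class calL P = R_class calL' P]) &
      rational_polyhedron (R_class calL P)].
Proof.
have [k [_ kP]] := cond_a; have [l [l0 lP]] := cond_b.
have [Gam [Gam0 PE]] := slice_int_cone_generators P P_ratpoly.
pose T := (\max_(g <- Gam) `|height g|)%N.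
pose M := ((l * k * T)`!)%N.
have M0 : (0 < M)%N by exact: fact_gt0.
have /choice[D DP] (L : set 'rV[R]_d) : exists D : seq 'rV[int]_(d + 1) *
      ('rV[int]_(d + 1) -> 'rV[int]_(d + 1) -> nat), calL L ->
    bounded_description (l * k)%N%:Z D.1 L /\
    forall g h, g \in Gam -> h \in Gam -> height g != 0 -> inside D.1 g ->
      crossing M D.1 g h (D.2 g h).
  have [LcalL|nL] := pselect (calL L); last by exists ([::], fun _ _ => 0%N).
  have [Lrat Ldim] := calL_ratpoly L LcalL.
  have [fs fsP] := lattice_description L k l l0 Lrat Ldim (kP L LcalL)
    (fun F => lP L F LcalL).
  have /choice[s sP] (gh : 'rV[int]_(d + 1) * 'rV[int]_(d + 1)) : exists s,
      gh.1 \in Gam -> height gh.1 != 0 -> inside fs gh.1 ->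
      crossing M fs gh.1 gh.2 s.
    have [gG|] := boolP (gh.1 \in Gam); last by exists 0%N.
    have [gin|] := boolP (inside fs gh.1); last by exists 0%N.
    have [g0|g0] := eqVneq (height gh.1) 0; first by exists 0%N.
    have [//|s sP] := @crossing_exists d M fs gh.1 gh.2 gin; last by exists s.
    move=> f ffs; rewrite dvdzE -abszN -dvdzE; have [_ /(_ f gh.1 ffs) fb _] := fsP.
    have hg : 0 < height gh.1 by rewrite lt_neqAle eq_sym g0 Gam0.
    apply: dvdz_fact_le; first by rewrite oppr_gt0; exact: (allP gin).
    apply: le_trans (fb hg gin) _; rewrite [leRHS]PoszM ler_wpM2l //.
    rewrite -[height _]gez0_abs ?Gam0 // lez_nat.
    exact: (@leq_bigmax_seq _ Gam xpredT (fun g => `|height g|%N)).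
  exists (fs, fun g h => s (g, h)) => _; split=> // g h gG hG g0 gin.
  exact: (sP (g, h)).
have RE L : calL L -> R_op L P = slice (int_cone (cut_gens Gam M (D L).1 (D L).2)).
  by move=> /DP[LD sP]; rewrite PE; apply: (R_op_slice _ _ _ _ LD).
pose js := [seq inl g | g <- Gam] ++ [seq inr (g, h) | g <- Gam, h <- Gam].
(* the natural numbers on which R_L(P) depends monotonically *)
pose f (j : 'rV[int]_(d + 1) + 'rV[int]_(d + 1) * 'rV[int]_(d + 1)) L : nat :=
  match j with inl g => ~~ inside (D L).1 g | inr (g, h) => (D L).2 g h end.
have [F [FcalL Ffin FP]] := dickson js f calL.
have Fdom L : calL L -> exists2 L', F L' & R_op L' P `<=` R_op L P.
  move=> LcalL; have [L' FL' L'P] := FP L LcalL; exists L' => //.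
  have L'calL := FcalL _ FL'; rewrite !RE // => x.
  apply: cut_gens_le => // [g h gG hG g0 gin|g gG|g h gG hG].
  - by have [_] := DP _ L'calL; apply.
  - have /L'P : inl g \in js by rewrite mem_cat map_f.
    by rewrite /f; case: inside; case: inside.
  - have /L'P // : inr (g, h) \in js.
    by rewrite mem_cat; apply/orP; right; apply/allpairsP; exists (g, h).
have RF : R_class calL P = R_class F P.
  apply/seteqP; split=> x xR L LL; first by apply: xR; exact: FcalL.
  by have [L' FL' L'L] := Fdom L LL; apply: L'L; exact: xR.
split.
- by exists F.
- exists F; split=> //; have [L LcalL] := calL_neq0.
  by have [L' FL' _] := Fdom L LcalL; exists L'.
- rewrite RF; apply: rational_polyhedron_bigcap => // L FL.
  rewrite RE; last exact: FcalL.
  have [A ->] := int_cone_polar (R := R) (cut_gens Gam M (D L).1 (D L).2).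
  exact: slice_rational_polyhedron.
Qed.
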